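(* Let $T$ be an h-inductive theory in a language $L$ and let $x$ be a finite tuple of variables. The map $p\mapsto p^*$, which maps a positive type $p(x)\in S_x(T)$ to the geometric type of any of its realisations (in positive models of $T$), is a bijection from $S_x(T)$ to the set of normal geometric types in variables $x$ which are consistent with $T$ and maximal with this property.
   Context: $L$ is a many-sorted first-order language containing two $0$-ary relation symbols $\top$ (true) and $\bot$ (false), interpreted in the obvious way. For an $L$-structure $M$ and a finite tuple $x$ of variables, $M_x$ is the set of tuples of elements of $M$ with the sorts of $x$. The notation $\phi(x)$ means that the free variables of $\phi$ are among the finite tuple $x$. A positive formula is a finitary formula built from atomic formulas using only finite conjunctions, finite disjunctions and existential quantifications. An h-inductive sentence is a finite conjunction of sentences of the form $\forall x\,(\phi(x)\Rightarrow\psi(x))$ with $\phi,\psi$ positive; an h-inductive theory is a set of h-inductive sentences. A homomorphism $f:A\to B$ of $L$-structures is a sorted map such that for every atomic sentence $\phi(a)$ with parameters in $A$, $A\models\phi(a)$ implies $B\models\phi(fa)$. It is an immersion if moreover for every positive sentence $\phi(a)$ with parameters in $A$, $B\models\phi(fa)$ implies $A\models\phi(a)$. A positive model of $T$ is a model $M$ of $T$ such that every homomorphism from $M$ into a model of $T$ is an immersion. A positive type of $T$ in variables $x$ is a set $p$ of positive formulas $\phi(x)$ such that $T\cup p(x)$ is consistent and $p$ is maximal with this property. $S_x(T)$ is the set of all such positive types. The positive types in $S_x(T)$ are exactly the sets $tp^+_M(a)=\{\phi(x)\text{ positive}: M\models\phi(a)\}$ for $M$ a positive model of $T$ and $a\in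 M_x$; such an $a$ is called a realisation of $p=tp^+_M(a)$. The geometric formulas of $L_{\infty\omega}$ form the smallest class of formulas (with finitely many free variables) containing the atomic formulas and closed under finite conjunctions, existential quantification over single variables, and arbitrary (set-indexed) disjunctions. A positive primitive (p.p.) formula is an existentially quantified finite conjunction of atomic formulas. A geometric formula is normal if it is a disjunction $\bigvee\Phi$ of a set $\Phi$ of p.p. formulas. A geometric type in variables $x$ is a set $\pi(x)$ of geometric formulas $\phi(x)$; it is normal if all its formulas are normal; it is consistent with $T$ if it is satisfied by some $a\in M_x$ in some model $M$ of $T$. The geometric type of $a\in M_x$ in an $L$-structure $M$ is the set $tp^g_M(a)$ of all normal geometric formulas $\phi(x)$ such that $M\models\phi(a)$. For $p\in S_x(T)$, $p^*$ is $tp^g_M(a)$ for any realisation $a$ of $p$ in a positive model $M$ of $T$; this does not depend on the choice of $M$ and $a$. *)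

(* Defs.v *)
From mathcomp Require Import all_boot boolp classical_sets functions.

Set Implicit Arguments.
Unset Strict Implicit.
Unset Printing Implicit Defensive.

Local Open Scope classical_set_scope.

(* A finite tuple of variables is given by the list [x] of its sorts; a
   formula phi(x), whose free variables are among x, is a well-scoped formula
   over the context [x].  Bound variables are added at the head. *)

Inductive var (S : Type) : seq S -> S -> Type :=
| var0 (s : S) (x : seq S) : var (s :: x) s
| varS (s t : S) (x : seq S) : var x s -> var (t :: x) s.

(* Tuples of elements of the sorted family [M] with the sorts of [x], i.e.
   [M_x], presented as families indexed by the variables (positions) of [x]. *)
Definition tuples (S : Type) (M : S -> Type) (x : seq S) : Type :=
  forall s, var x s -> M s.

Definition tcons (S : Type) (M : S -> Type) (s : S) (x : seq S) (m : M s)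
    (a : tuples M x) : tuples M (s :: x) :=
  fun t v =>
    match v in var y t0
      return match y with
             | [::] => unit
             | s0 :: x0 => M s0 -> tuples M x0 -> M t0
             end
    with
    | var0 _ _ => fun m _ => m
    | varS _ _ _ w => fun _ a => a _ w
    end m a.

Definition tmap (S : Type) (M N : S -> Type) (f : forall s, M s -> N s)
    (x : seq S) (a : tuples M x) : tuples N x :=
  fun s v => f s (a s v).

Record language := Language {
  sorts : Type;
  fun_sym : Type;
  fun_dom : fun_sym -> seq sorts;
  fun_cod : fun_sym -> sorts;
  rel_sym : Type;
  rel_dom : rel_sym -> seq sorts }.

Inductive term (L : language) (x : seq (sorts L)) : sorts L -> Type :=
| t_var s (v : var x s) : term x s
| t_app (f : fun_sym L) (ts : forall s, var (fun_dom f) s -> term x s) :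
    term x (fun_cod f).

(* The distinguished 0-ary relation symbols true and false, which belong to
   every language and have a fixed interpretation, are the constructors [a_top]
   and [a_bot]; they are not listed in [rel_sym]. *)
Inductive atomic (L : language) (x : seq (sorts L)) : Type :=
| a_top : atomic x
| a_bot : atomic x
| a_eq s (t u : term x s) : atomic x
| a_rel (R : rel_sym L) (ts : forall s, var (rel_dom R) s -> term x s) :
    atomic x.

Arguments a_top {L x}.
Arguments a_bot {L x}.

(* Binary connectives suffice: the empty conjunction and the empty disjunction
   are the atomic formulas [a_top] and [a_bot]. *)
Inductive positive_formula (L : language) (x : seq (sorts L)) : Type :=
| p_atom (alpha : atomic x)
| p_and (phi psi : positive_formula x)
| p_or (phi psi : positive_formula x)
| p_ex s (phi : positive_formula (s :: x)).

Inductive conj_atomic (L : language) (x : seq (sorts L)) : Type :=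
| c_atom (alpha : atomic x)
| c_and (phi psi : conj_atomic x).

Inductive pp (L : language) (x : seq (sorts L)) : Type :=
| pp_conj (phi : conj_atomic x)
| pp_ex s (phi : pp (s :: x)).

Inductive geometric_formula (L : language) (x : seq (sorts L)) : Type :=
| g_atom (alpha : atomic x)
| g_and (phi psi : geometric_formula x)
| g_ex s (phi : geometric_formula (s :: x))
| g_or (I : Type) (phi : I -> geometric_formula x).

Fixpoint geom_of_conj L (x : seq (sorts L)) (phi : conj_atomic x) :
    geometric_formula x :=
  match phi with
  | c_atom alpha => g_atom alpha
  | c_and phi psi => g_and (geom_of_conj phi) (geom_of_conj psi)
  end.

Fixpoint geom_of_pp L (x : seq (sorts L)) (phi : pp x) : geometric_formula x :=
  match phi with
  | pp_conj phi => geom_of_conj phi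
  | pp_ex _ phi => g_ex (geom_of_pp phi)
  end.

(* The disjunction of a set of p.p. formulas, indexed by that set itself *)
Definition bigor L (x : seq (sorts L)) (Phi : set (pp x)) :
    geometric_formula x :=
  g_or (fun phi : {phi : pp x | Phi phi} => geom_of_pp (sval phi)).

Definition normal L (x : seq (sorts L)) (phi : geometric_formula x) : Prop :=
  exists Phi : set (pp x), phi = bigor Phi.

(* Sorts may be interpreted by empty types. *)
Record structure (L : language) := Structure {
  carrier :> sorts L -> Type;
  fun_interp : forall f : fun_sym L,
    tuples carrier (fun_dom f) -> carrier (fun_cod f);
  rel_interp : forall R : rel_sym L, tuples carrier (rel_dom R) -> Prop }.

Fixpoint eval L (M : structure L) (x : seq (sorts L)) (a : tuples M x) s
    (t : term x s) : M s :=
  match t with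
  | t_var _ v => a _ v
  | t_app f ts => @fun_interp L M f (fun s v => eval a (ts s v))
  end.

Definition sat_atomic L (M : structure L) (x : seq (sorts L)) (alpha : atomic x)
    (a : tuples M x) : Prop :=
  match alpha with
  | a_top => True
  | a_bot => False
  | a_eq _ t u => eval a t = eval a u
  | a_rel R ts => @rel_interp L M R (fun s v => eval a (ts s v))
  end.

Fixpoint sat_positive L (M : structure L) (x : seq (sorts L))
    (phi : positive_formula x) : tuples M x -> Prop :=
  match phi with
  | p_atom alpha => fun a => sat_atomic alpha a
  | p_and phi psi => fun a => sat_positive phi a /\ sat_positive psi a
  | p_or phi psi => fun a => sat_positive phi a \/ sat_positive psi a
  | p_ex s phi => fun a => exists m : M s, sat_positive phi (tcons m a)
  end.

Fixpoint sat_geometric L (M : structure L) (x : seq (sorts L))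
    (phi : geometric_formula x) : tuples M x -> Prop :=
  match phi with
  | g_atom alpha => fun a => sat_atomic alpha a
  | g_and phi psi => fun a => sat_geometric phi a /\ sat_geometric psi a
  | g_ex s phi => fun a => exists m : M s, sat_geometric phi (tcons m a)
  | g_or _ phi => fun a => exists i, sat_geometric (phi i) a
  end.

(* The sentence "forall x, phi(x) => psi(x)" *)
Record h_implication (L : language) := HImplication {
  hi_ctx : seq (sorts L);
  hi_hyp : positive_formula hi_ctx;
  hi_concl : positive_formula hi_ctx }.

(* A list stands for the conjunction of its elements. *)
Definition h_inductive (L : language) := seq (h_implication L).

Definition sat_h_implication L (M : structure L) (c : h_implication L) : Prop :=
  forall a : tuples M (hi_ctx c),
    sat_positive (hi_hyp c) a -> sat_positive (hi_concl c) a.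

Fixpoint sat_h_inductive L (M : structure L) (theta : h_inductive L) : Prop :=
  if theta is c :: theta' then sat_h_implication M c /\ sat_h_inductive M theta'
  else True.

Definition theory (L : language) := set (h_inductive L).

Definition model L (T : theory L) (M : structure L) : Prop :=
  forall theta, T theta -> sat_h_inductive M theta.

Definition homomorphism L (A B : structure L) (f : forall s, A s -> B s) :
    Prop :=
  forall (x : seq (sorts L)) (alpha : atomic x) (a : tuples A x),
    sat_atomic alpha a -> sat_atomic alpha (tmap f a).

Definition immersion L (A B : structure L) (f : forall s, A s -> B s) : Prop :=
  homomorphism f /\
  forall (x : seq (sorts L)) (phi : positive_formula x) (a : tuples A x),
    sat_positive phi (tmap f a) -> sat_positive phi a.

Definition positive_model L (T : theory L) (M : structure L) : Prop :=
  model T M /\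
  forall (N : structure L) (f : forall s, M s -> N s),
    model T N -> homomorphism f -> immersion f.

Definition maximal_with (X : Type) (P : set (set X)) : set (set X) :=
  [set p | P p /\ forall q, P q -> p `<=` q -> q = p].

Definition consistent_positive L (T : theory L) (x : seq (sorts L)) :
    set (set (positive_formula x)) :=
  [set p | exists (M : structure L) (a : tuples M x),
    model T M /\ forall phi, p phi -> sat_positive phi a].

Arguments consistent_positive {L} T x.

Definition positive_types L (T : theory L) (x : seq (sorts L)) :
    set (set (positive_formula x)) :=
  maximal_with (consistent_positive T x).

Arguments positive_types {L} T x.

Definition tp_positive L (M : structure L) (x : seq (sorts L))
    (a : tuples M x) : set (positive_formula x) :=
  [set phi | sat_positive phi a].

Definition normal_type L (x : seq (sorts L)) : set (set (geometric_formula x)) :=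
  [set q | forall phi, q phi -> normal phi].

Arguments normal_type {L} x.

Definition consistent_geometric L (T : theory L) (x : seq (sorts L)) :
    set (set (geometric_formula x)) :=
  [set q | exists (M : structure L) (a : tuples M x),
    model T M /\ forall phi, q phi -> sat_geometric phi a].

Arguments consistent_geometric {L} T x.

Definition maximal_normal_types L (T : theory L) (x : seq (sorts L)) :
    set (set (geometric_formula x)) :=
  maximal_with (normal_type x `&` consistent_geometric T x).

Arguments maximal_normal_types {L} T x.

Definition tp_geometric L (M : structure L) (x : seq (sorts L))
    (a : tuples M x) : set (geometric_formula x) :=
  [set phi | normal phi /\ sat_geometric phi a].

Definition realisation L (T : theory L) (x : seq (sorts L))
    (p : set (positive_formula x)) (M : structure L) (a : tuples M x) : Prop :=
  positive_model T M /\ p = tp_positive a.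

(* [star T x p] is p^*: the geometric type of a chosen realisation of [p]
   (a junk value if [p] has no realisation). *)
Definition star L (T : theory L) (x : seq (sorts L))
    (p : set (positive_formula x)) :
    set (geometric_formula x) :=
  get [set q | exists (M : structure L) (a : tuples M x),
    realisation T p a /\ q = tp_geometric a].

Arguments star {L} T x p.

(* Main.v *)
Require Import Defs.
From mathcomp Require Import all_boot boolp classical_sets functions.
From Stdlib Require List.

(** A normal geometric type is the same information as a positive type.
    A positive formula is equivalent to the disjunction of the p.p. formulas
    that imply it (sat_bigor_pp_below), so the geometric type of a tuple
    determines its positive type; conversely a disjunction of p.p. formulas
    holds as soon as one of them does, and p.p. formulas are positive, so that
    an inclusion of positive types gives an inclusion of geometric types
    (tp_geometric_mono).  What remains is model theory:

    - every tuple in a model of [T] has its positive type contained in that of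
      a tuple of a positive model (tp_positive_in_positive_model), so that
      positive types are realised, and a maximal normal type, which is
      satisfied somewhere, is the geometric type of such a tuple;
    - the positive type of a tuple [b] in a positive model [N] is maximal
      (tp_positive_maximal): if [q] contains it and is satisfied in a model,
      then [N] maps homomorphically to a model of [T] in which the image of
      [b] satisfies [q]; this map is an immersion, so [b] satisfies [q] too.

    Both come from realisation_in_positive_model, which combines compactness
    with the construction of positive models.  Given a family [B] of
    parameters, adjoin Henkin witnesses freely, and consider sets of positive
    statements about the resulting symbols, every finite subset of which is
    satisfied in a model of [T].  As sorts may be empty, symbols are
    interpreted by partial functions: the witness of an existential statement
    denotes something exactly when this statement is true.  By Zorn's lemma
    such a set extends to a maximal one, and the symbols that a maximal set [G]
    declares to denote something form, up to provable equality, a model of [T]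
    whose true positive statements are the members of [G].  Maximality of [G]
    is what makes this model positive: a positive statement true in a
    homomorphic image is consistent with [G], hence belongs to it.

    For the homomorphism out of [N] one needs that the atomic diagram of [N]
    together with [q] is finitely satisfiable.  Finitely many facts of the
    diagram follow, after quantifying the elements outside [b]
    existentially, from a single positive formula in the type of [b]
    (local_type), and this formula belongs to [q]. *)

Set Implicit Arguments.
Unset Strict Implicit.
Unset Printing Implicit Defensive.

Local Open Scope classical_set_scope.

(** * Tuples and renaming of variables *)

Lemma var_nil (S : Type) (s : S) (v : var [::] s) : False.
Proof. by inversion v. Qed.

(** Case analysis on a variable of a nonempty context; plain destruction is not
    available because the context index is not a variable. *)
Lemma var_case (S : Type) (s : S) (x : seq S)
    (P : forall t, var (s :: x) t -> Prop) :
  P s (var0 s x) -> (forall t v, P t (varS s v)) -> forall t v, P t v.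
Proof.
move=> P0 PS t v.
refine (match v as v' in var y t' return
  match y return var y t' -> Prop with
  | [::] => fun _ => True
  | s0 :: x0 => fun v' => forall Q : forall t, var (s0 :: x0) t -> Prop,
      Q s0 (var0 s0 x0) -> (forall t v, Q t (varS s0 v)) -> Q t' v'
  end v' with
  | var0 _ _ => _
  | varS _ _ _ _ => _
  end P P0 PS) => Q Q0 QS //.
Qed.

Lemma tuples_eq (S : Type) (M : S -> Type) (x : seq S) (a b : tuples M x) :
  (forall s v, a s v = b s v) -> a = b.
Proof.
by move=> ab; apply: functional_extensionality_dep => s;
   apply: functional_extensionality_dep => v.
Qed.

Lemma tmap_tcons (S : Type) (M N : S -> Type) (f : forall s, M s -> N s)
    (s : S) (x : seq S) (m : M s) (a : tuples M x) :
  tmap f (tcons m a) = tcons (f s m) (tmap f a).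
Proof. by apply: tuples_eq; apply: var_case. Qed.

(** A renaming of the variables [x] into variables [y] is a tuple of variables
    [r : tuples (var y) x]; it turns a tuple [a] over [y] into [tmap a r]. *)
Definition lift_renaming (S : Type) (x y : seq S) (s : S)
    (r : tuples (var y) x) : tuples (var (s :: y)) (s :: x) :=
  tcons (var0 s y) (fun t v => varS s (r t v)).

Arguments lift_renaming {S x y} s r.

Lemma tmap_lift_renaming (S : Type) (M : S -> Type) (x y : seq S) (s : S)
    (r : tuples (var y) x) (m : M s) (a : tuples M y) :
  tmap (tcons m a) (lift_renaming s r) = tcons m (tmap a r).
Proof. by apply: tuples_eq; apply: var_case. Qed.

Definition weakening (S : Type) (s : S) (x : seq S) :
    tuples (var (s :: x)) x := fun t v => varS s v.

Arguments weakening {S} s x.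

Section Renaming.
Context (L : language).
Implicit Types (x y : seq (sorts L)).

Fixpoint rename_term x y (r : tuples (var y) x) s (t : term x s) : term y s :=
  match t with
  | t_var _ v => t_var (r _ v)
  | t_app f ts => t_app (fun s v => rename_term r (ts s v))
  end.

Definition rename_atomic x y (r : tuples (var y) x) (alpha : atomic x) :
    atomic y :=
  match alpha with
  | a_top => a_top
  | a_bot => a_bot
  | a_eq _ t u => a_eq (rename_term r t) (rename_term r u)
  | a_rel R ts => a_rel (fun s v => rename_term r (ts s v))
  end.

Fixpoint rename_conj x y (r : tuples (var y) x) (phi : conj_atomic x) :
    conj_atomic y :=
  match phi with
  | c_atom alpha => c_atom (rename_atomic r alpha)
  | c_and phi psi => c_and (rename_conj r phi) (rename_conj r psi)
  end.

Fixpoint rename_pp x y (r : tuples (var y) x) (phi : pp x) : pp y :=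
  match phi with
  | pp_conj phi => pp_conj (rename_conj r phi)
  | pp_ex s phi => pp_ex (rename_pp (lift_renaming s r) phi)
  end.

Context (M : structure L).

Lemma eval_rename x y (r : tuples (var y) x) (a : tuples M y) s
    (t : term x s) : eval a (rename_term r t) = eval (tmap a r) t.
Proof.
by elim: t => // f ts IH /=; congr fun_interp; apply: tuples_eq => t v; apply: IH.
Qed.

Lemma sat_rename_atomic x y (r : tuples (var y) x) (a : tuples M y)
    (alpha : atomic x) :
  sat_atomic (rename_atomic r alpha) a <-> sat_atomic alpha (tmap a r).
Proof.
case: alpha => //= [s t u|R ts]; first by rewrite !eval_rename.
set b := fun s v => _; set c := fun s v => _.
suff -> : b = c by [].
by apply: tuples_eq => s v; apply: eval_rename.
Qed.

Lemma sat_rename_conj x y (r : tuples (var y) x) (a : tuples M y)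
    (phi : conj_atomic x) :
  sat_geometric (geom_of_conj (rename_conj r phi)) a <->
  sat_geometric (geom_of_conj phi) (tmap a r).
Proof.
elim: phi => [alpha|phi IHphi psi IHpsi] /=; first exact: sat_rename_atomic.
by rewrite IHphi IHpsi.
Qed.

Lemma sat_rename_pp x y (r : tuples (var y) x) (a : tuples M y) (phi : pp x) :
  sat_geometric (geom_of_pp (rename_pp r phi)) a <->
  sat_geometric (geom_of_pp phi) (tmap a r).
Proof.
elim: phi y r a => [x' phi|x' s phi IH] y r a /=; first exact: sat_rename_conj.
by split=> -[m am]; exists m; move: am; rewrite IH tmap_lift_renaming.
Qed.

End Renaming.

Lemma sat_positive_hom (L : language) (M N : structure L) (g : forall s, M s -> N s)
    (y : seq (sorts L)) (phi : positive_formula y) (a : tuples M y) :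
  homomorphism g -> sat_positive phi a -> sat_positive phi (tmap g a).
Proof.
move=> hg; elim: phi a => {y} [y alpha|y phi IHphi psi IHpsi|y phi IHphi psi IHpsi|y s phi IH] a /=.
- exact: hg.
- by move=> [/IHphi ? /IHpsi ?].
- by move=> [/IHphi ?|/IHpsi ?]; [left|right].
- by move=> [m /IH]; rewrite tmap_tcons => ?; exists (g s m).
Qed.

(** * Positive formulas as disjunctions of p.p. formulas *)

Section NormalForm.
Context (L : language).
Implicit Types (x y : seq (sorts L)) (M N : structure L).

Local Notation sat_pp phi a := (sat_geometric (geom_of_pp phi) a).

Lemma pp_and_conj x (c : conj_atomic x) (phi : pp x) :
  exists psi : pp x, forall M (a : tuples M x),
    sat_pp psi a <-> sat_geometric (geom_of_conj c) a /\ sat_pp phi a.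
Proof.
elim: phi c => {x} [x d|x s phi IH] c; first by exists (pp_conj (c_and c d)).
have [psi psiP] := IH (rename_conj (weakening s x) c).
exists (pp_ex psi) => M a /=; split.
  by move=> [m /psiP[/sat_rename_conj ? ?]]; split=> //; exists m.
by move=> [ca [m ?]]; exists m; apply/psiP; split=> //; apply/sat_rename_conj.
Qed.

(** The existential quantifiers of both formulas are pulled out, and the other
    conjunct is weakened under each of them. *)
Lemma pp_and x (phi1 phi2 : pp x) :
  exists psi : pp x, forall M (a : tuples M x),
    sat_pp psi a <-> sat_pp phi1 a /\ sat_pp phi2 a.
Proof.
elim: phi1 phi2 => {x} [x c|x s phi IH] phi2; first exact: pp_and_conj.
have [psi psiP] := IH (rename_pp (weakening s x) phi2).
exists (pp_ex psi) => M a /=; split.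
  by move=> [m /psiP[? /sat_rename_pp ?]]; split=> //; exists m.
by move=> [[m ?] ?]; exists m; apply/psiP; split=> //; apply/sat_rename_pp.
Qed.

(** The set of all p.p. formulas that imply [phi] in every structure: since a
    positive formula is equivalent to a disjunction of p.p. formulas, it is
    equivalent to the disjunction of this canonical set. *)
Definition pp_below x (phi : positive_formula x) : set (pp x) :=
  [set theta | forall M (a : tuples M x), sat_pp theta a -> sat_positive phi a].

Lemma pp_below_cover x (phi : positive_formula x) M (a : tuples M x) :
  sat_positive phi a -> exists2 theta, pp_below phi theta & sat_pp theta a.
Proof.
elim: phi a => {x} [x alpha|x phi IHphi psi IHpsi|x phi IHphi psi IHpsi|x s phi IH] a /=.
- by exists (pp_conj (c_atom alpha)).
- move=> [/IHphi[t1 t1P at1] /IHpsi[t2 t2P at2]].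
  have [t tP] := pp_and t1 t2.
  by exists t; [move=> N b /tP[/t1P ? /t2P ?] | apply/tP].
- move=> [/IHphi|/IHpsi] [t tP at_]; exists t => // N b /tP ?; by [left|right].
- move=> [m /IH[t tP at_]]; exists (pp_ex t); last by exists m.
  by move=> N b [n /tP ?]; exists n.
Qed.

Lemma sat_bigor_pp_below x (phi : positive_formula x) M (a : tuples M x) :
  sat_geometric (bigor (pp_below phi)) a <-> sat_positive phi a.
Proof.
split=> [[[t tP] /= /tP]|/pp_below_cover[t tP at_]] //.
by exists (exist _ t tP).
Qed.

Fixpoint positive_of_conj x (phi : conj_atomic x) : positive_formula x :=
  match phi with
  | c_atom alpha => p_atom alpha
  | c_and phi psi => p_and (positive_of_conj phi) (positive_of_conj psi)
  end.

Fixpoint positive_of_pp x (phi : pp x) : positive_formula x :=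
  match phi with
  | pp_conj phi => positive_of_conj phi
  | pp_ex _ phi => p_ex (positive_of_pp phi)
  end.

Lemma sat_positive_of_pp x (phi : pp x) M (a : tuples M x) :
  sat_positive (positive_of_pp phi) a <-> sat_pp phi a.
Proof.
elim: phi a => {x} [x c|x s phi IH] a /=.
  by elim: c => //= c IHc d IHd; rewrite IHc IHd.
by split=> -[m /IH ?]; exists m.
Qed.

Lemma tp_geometric_mono x M N (a : tuples M x) (b : tuples N x) :
  tp_positive a `<=` tp_positive b -> tp_geometric a `<=` tp_geometric b.
Proof.
move=> ab phi [[Phi ->] [[t tP] /= at_]]; split; first by exists Phi.
by exists (exist _ t tP); apply/sat_positive_of_pp/ab/sat_positive_of_pp.
Qed.

(** The type [q] is only assumed to contain the geometric type of [a]: this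
    form serves both to compare [a] with a realisation of a larger type and to
    recover a positive type from a geometric one. *)
Lemma tp_positive_of_geometric x M N (a : tuples M x) (b : tuples N x)
    (q : set (geometric_formula x)) :
  tp_geometric a `<=` q -> (forall phi, q phi -> sat_geometric phi b) ->
  tp_positive a `<=` tp_positive b.
Proof.
move=> aq qb phi aphi; apply/sat_bigor_pp_below/qb/aq.
by split; [exists (pp_below phi) | apply/sat_bigor_pp_below].
Qed.

End NormalForm.

(** * Symbols, valuations and facts *)

Section Henkin.
Context (L : language) (T : theory L) (B : sorts L -> Type).
Implicit Types (x y : seq (sorts L)) (M N : structure L).

Inductive symbol : sorts L -> Type :=
| given s (b : B s) : symbol s
| witness s y (v : forall t, var y t -> symbol t)
    (phi : positive_formula (s :: y)) : symbol s.

(** A valuation is partial: a given symbol need not denote anything in a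
    structure into which only some of the parameters are mapped, and a witness
    cannot denote anything in an empty sort. *)
Record valuation := Valuation {
  target : structure L;
  val : forall s, symbol s -> option (target s) }.

Definition values (k : valuation) y (v : tuples symbol y)
    (a : tuples (target k) y) : Prop :=
  forall s i, val k (v s i) = Some (a s i).

Record fact := Fact {
  fact_ctx : seq (sorts L);
  fact_args : tuples symbol fact_ctx;
  fact_formula : positive_formula fact_ctx }.

Arguments fact_args : clear implicits.

Definition holds (k : valuation) (F : fact) : Prop :=
  exists a, values (fact_args F) a /\
            @sat_positive L (target k) _ (fact_formula F) a.

(** The two Henkin conditions: a witness that denotes something is a true
    witness, and a witness denotes something as soon as one exists. *)
Definition admissible (k : valuation) : Prop :=
  [/\ model T (target k),
      forall s y (v : tuples symbol y) (phi : positive_formula (s :: y)) m,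
        val k (witness v phi) = Some m ->
        exists a, values v a /\ sat_positive phi (tcons m a) &
      forall s y (v : tuples symbol y) (phi : positive_formula (s :: y)),
        holds k (Fact v (p_ex phi)) ->
        exists m, val k (witness v phi) = Some m].

(** A prescribed partial valuation [d] that respects the first Henkin condition
    is completed by choosing witnesses, by recursion on symbols.  The general
    [d] is needed for the images of term models, where the prescribed witnesses
    are not the chosen ones. *)
Lemma admissible_extension N (d : forall s, symbol s -> option (N s)) :
  model T N ->
  (forall s y (v : tuples symbol y) (phi : positive_formula (s :: y)) m,
     d s (witness v phi) = Some m ->
     exists a : tuples N y, (forall t i, d t (v t i) = Some (a t i)) /\
                            sat_positive phi (tcons m a)) ->
  exists e : forall s, symbol s -> option (N s),
    admissible (Valuation e) /\ forall s w m, d s w = Some m -> e s w = Some m.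
Proof.
move=> TN dP.
pose e := fix e s (w : symbol s) : option (N s) :=
  match w in symbol s0 return option (N s0) -> option (N s0) with
  | given _ b => id
  | witness s0 y v phi => fun dw =>
      if dw is Some m then Some m else
      if pselect (exists m, exists a : tuples N y,
          (forall t i, e t (v t i) = Some (a t i)) /\
          sat_positive phi (tcons m a)) is left ex
      then Some (projT1 (cid ex)) else None
  end (d s w).
have de s w m : d s w = Some m -> e s w = Some m by case: w m => //= s' y v phi m ->.
exists e; split=> //; split=> //=.
- move=> s y v phi m; case dw: (d _ _) => [m'|] /=.
    move=> [<-]; have [a [da am]] := dP _ _ _ _ _ dw.
    by exists a; split=> // t i; apply: de.
  by case: pselect => // ex [<-]; case: cid.
- move=> s y v phi [a [/= va [m am]]]; case: (d _ _) => [m'|]; first by exists m'.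
  case: pselect => [ex|[]]; first by eexists.
  by exists m, a.
Qed.

Lemma admissible_of_partial_map N (h : forall s, B s -> option (N s)) :
  model T N ->
  exists e : forall s, symbol s -> option (N s),
    admissible (Valuation e) /\
    forall s b m, h s b = Some m -> e s (given b) = Some m.
Proof.
move=> TN.
pose d s (w : symbol s) : option (N s) :=
  match w in symbol s0 return option (N s0) with
  | given _ b => h _ b
  | witness _ _ _ _ => None
  end.
have [//|e [ea de]] := @admissible_extension N d TN.
by exists e; split=> // s b m hb; apply: de.
Qed.

Definition given_fact y (b : tuples B y) (phi : positive_formula y) : fact :=
  Fact (fun s i => given (b s i)) phi.

Definition consistent_facts (G : set fact) : Prop :=
  forall l : seq fact, (forall F, List.In F l -> G F) ->
  exists k, admissible k /\ forall F, List.In F l -> holds k F.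

Lemma maximal_consistent_extension (G0 : set fact) :
  consistent_facts G0 ->
  exists G, [/\ G0 `<=` G, consistent_facts G &
    forall F, consistent_facts (F |` G) -> G F].
Proof.
move=> G0c.
have chain (C : set (set fact)) :
    (C `<=` [set X | consistent_facts (G0 `|` X)]) -> total_on C subset ->
    consistent_facts (G0 `|` \bigcup_(X in C) X).
  move=> CP Ctot l lG.
  have : (forall F, List.In F l -> G0 F) \/
      exists X, C X /\ forall F, List.In F l -> (G0 `|` X) F.
    elim: l lG => [|F l IH] lG; first by left.
    have {}IH := IH (fun F' F'l => lG F' (or_intror F'l)).
    have [G0F|[X CX XF]] := lG F (or_introl erefl).
      case: IH => [lG0|[X [CX lX]]]; [left|right; exists X; split=> //].
        by move=> F' [<-|/lG0].
      by move=> F' [<-|/lX] //; left.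
    right; case: IH => [lG0|[Y [CY lY]]].
      exists X; split=> // F' [<-|/lG0]; by [left|right].
    have [XY|YX] := Ctot _ _ CX CY.
      exists Y; split=> // F' [<-|/lY] //; by right; apply: XY.
    exists X; split=> // F' [<-|/lY[|/YX]]; by [left|right].
  case=> [/G0c//|[X [CX lX]]]; exact: (CP _ CX).
have [A [Ac Amax]] := Zorn_bigcup chain.
exists (G0 `|` A); split=> // F Fc; right.
have [//|nAF] := pselect (A F).
case: (Amax (F |` A)); first by split; [exact: subsetUr | move=> /(_ F (or_introl erefl))].
by rewrite /= setUCA.
Qed.

(** * The model of a maximal consistent set of facts *)

Section TermModel.
Context (G : set fact).
Context (Gc : consistent_facts G).
Context (Gmax : forall F, consistent_facts (F |` G) -> G F).

(** Semantic consequence of finitely many members of [G]. *)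
Definition forces (P : valuation -> Prop) : Prop :=
  exists2 l : seq fact, (forall F, List.In F l -> G F) &
  forall k, admissible k -> (forall F, List.In F l -> holds k F) -> P k.

Lemma forces_mono (P Q : valuation -> Prop) :
  (forall k, admissible k -> P k -> Q k) -> forces P -> forces Q.
Proof. by move=> PQ [l lG lP]; exists l => // k ka /(lP k ka)/(PQ k ka). Qed.

Lemma forces_all (P : valuation -> Prop) :
  (forall k, admissible k -> P k) -> forces P.
Proof. by move=> HP; exists [::] => // k /HP. Qed.

Lemma forces_and (P Q : valuation -> Prop) :
  forces P -> forces Q -> forces (fun k => P k /\ Q k).
Proof.
move=> [l lG lP] [l' lG' lQ]; exists (l ++ l').
  by move=> F /List.in_app_iff[/lG|/lG'].
move=> k ka kl; split.
  by apply: lP => // F Fl; apply/kl/List.in_app_iff; left.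
by apply: lQ => // F Fl; apply/kl/List.in_app_iff; right.
Qed.

Lemma forces_tuple y (P : forall s, var y s -> valuation -> Prop) :
  (forall s i, forces (P s i)) -> forces (fun k => forall s i, P s i k).
Proof.
elim: y P => [|s y IH] P HP.
  by apply: forces_all => k _ s i; case: (var_nil i).
have := forces_and (HP _ (var0 s y)) (IH _ (fun t i => HP _ (varS s i))).
by apply: forces_mono => k _ [P0 PS]; apply: var_case.
Qed.

Lemma forces_consistent (P : valuation -> Prop) :
  forces P -> exists2 k, admissible k & P k.
Proof. by move=> [l /Gc[k [ka kl]] lP]; exists k => //; apply: lP. Qed.

(** A maximal set is closed under its consequences. *)
Lemma forcesP F : forces (fun k => holds k F) <-> G F.
Proof.
split=> [FG|FG]; last first.
  by exists [:: F] => [F' [<-|//]|k _ kF] //; apply: kF; left.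
apply: Gmax => l lFG.
have : forces (fun k => forall F, List.In F l -> holds k F).
  elim: l lFG => [|F' l IH] lFG; first exact: forces_all.
  have HF' : forces (fun k => holds k F').
    have [->//|GF'] := lFG F' (or_introl erefl).
    by exists [:: F'] => [F1 [<-|//]|k _ kF] //; apply: kF; left.
  apply: forces_mono (forces_and HF' (IH (fun F1 h => lFG F1 (or_intror h)))).
  by move=> k _ [? ?] F1 [<-|]; auto.
by move=> /forces_consistent[k]; exists k.
Qed.

(** A fact outside a maximal set is refuted by finitely many of its members;
    two such refutations combine. *)
Lemma forces_or F1 F2 :
  forces (fun k => holds k F1 \/ holds k F2) -> G F1 \/ G F2.
Proof.
have refute F : ~ G F -> forces (fun k => ~ holds k F).
  move=> nGF; apply: contrapT => nf; apply: nGF; apply: Gmax => l lFG.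
  apply: contrapT => nk; apply: nf.
  exists (List.filter (fun F' => `[< F' <> F >]) l).
    by move=> F' /List.filter_In[/lFG[->|//]] /asboolP.
  move=> k ka kl kF; apply: nk; exists k; split=> // F' F'l.
  have [->//|nF] := pselect (F' = F).
  by apply: kl; apply/List.filter_In; split=> //; apply/asboolP.
move=> F12; apply: contrapT => /not_orP[/refute r1 /refute r2].
have [k _ [[]//]] := forces_consistent (forces_and F12 (forces_and r1 r2)).
  by move=> k1 [n1 _].
by move=> k2 [_ n2].
Qed.

(** Provable equality.  It is only a partial equivalence relation: its domain
    consists of the symbols that provably denote something. *)
Definition same s (w w' : symbol s) : Prop :=
  forces (fun k => exists m, val k w = Some m /\ val k w' = Some m).

Lemma same_sym s (w w' : symbol s) : same w w' -> same w' w.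
Proof. by apply: forces_mono => k _ [m []]; exists m. Qed.

Lemma same_trans s (w1 w2 w3 : symbol s) :
  same w1 w2 -> same w2 w3 -> same w1 w3.
Proof.
move=> h12 h23; apply: forces_mono (forces_and h12 h23).
by move=> k _ [[m [e1 e2]] [m' []]]; rewrite e2 => -[<-] e3; exists m.
Qed.

Lemma sameE s (w : symbol s) :
  same w w <-> forces (fun k => exists m, val k w = Some m).
Proof. by split; apply: forces_mono => k _ [m]; [case|]; exists m. Qed.

(** Classes are predicates of type [symbol s -> Prop]; the model is built on
    them so that provably equal symbols give equal elements. *)
Definition element s : Type :=
  {c : symbol s -> Prop | exists w, same w w /\ c = same w}.

Definition names s (c : element s) (w : symbol s) : Prop := sval c w.

Lemma names_ex s (c : element s) : exists w, names c w.
Proof. by case: c => c [w [ww cE]]; exists w; rewrite /names /= cE. Qed.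

Lemma names_of s (w : symbol s) : same w w -> exists c : element s, names c w.
Proof. by move=> ww; exists (exist _ (same w) (ex_intro _ w (conj ww erefl))). Qed.

Lemma names_same s (c : element s) w w' : names c w -> (names c w' <-> same w w').
Proof.
case: c => c [w0 [ww0 cE]]; rewrite /names /= cE => w0w; split.
  by apply: same_trans; apply: same_sym.
exact: same_trans.
Qed.

Lemma names_refl s (c : element s) w : names c w -> same w w.
Proof. by move=> cw; apply/(names_same _ cw). Qed.

Lemma names_inj s (c c' : element s) w : names c w -> names c' w -> c = c'.
Proof.
move=> cw cw'.
have E : sval c = sval c'.
  apply: functional_extensionality_dep => w'; apply: propext.
  by rewrite -/(names c w') (names_same _ cw) -(names_same _ cw').
case: c c' E {cw cw'} => c cP [c' cP'] /= E.
by subst c'; congr exist; apply: Prop_irrelevance.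
Qed.

Definition name s (c : element s) : symbol s := projT1 (cid (names_ex c)).

Lemma nameP s (c : element s) : names c (name c).
Proof. by rewrite /name; case: cid. Qed.

Definition names_tuple y (c : tuples element y) (v : tuples symbol y) : Prop :=
  forall s i, names (c s i) (v s i).

(** The witness of [exists z, z = f(v)]: witnesses also do the work of compound
    terms, so symbols need no constructor for function application. *)
Definition app_symbol (f : fun_sym L) (v : tuples symbol (fun_dom f)) :
    symbol (fun_cod f) :=
  witness v (p_atom (a_eq (t_var (var0 (fun_cod f) (fun_dom f)))
                          (t_app (fun s i => t_var (varS (fun_cod f) i))))).

Lemma val_app_symbol k f v (a : tuples (target k) (fun_dom f)) :
  admissible k -> values v a ->
  val k (app_symbol v) = Some (fun_interp (s := target k) a).
Proof.
move=> [_ strict total] va.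
have [|m wm] := total _ _ v _ (_ : holds k (Fact v (p_ex (p_atom (a_eq
   (t_var (var0 (fun_cod f) (fun_dom f)))
   (t_app (fun s i => t_var (varS (fun_cod f) i)))))))).
  by exists a; split=> //; exists (fun_interp (s := target k) a).
rewrite /app_symbol wm.
have [b [vb /= ->]] := strict _ _ _ _ _ wm.
congr Some; congr fun_interp; apply: tuples_eq => s i.
by have := va s i; rewrite vb => -[].
Qed.

Lemma same_tuple y (v v' : tuples symbol y) :
  (forall s i, same (v s i) (v' s i)) ->
  forces (fun k => exists a : tuples (target k) y, values v a /\ values v' a).
Proof.
move=> /forces_tuple; apply: forces_mono => k _ h.
pose a : tuples (target k) y := fun s i => projT1 (cid (h s i)).
by exists a; split=> s i; rewrite /a; case: cid => m [].
Qed.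

Lemma same_app_symbol f (v v' : tuples symbol (fun_dom f)) :
  (forall s i, same (v s i) (v' s i)) -> same (app_symbol v) (app_symbol v').
Proof.
move=> /same_tuple; apply: forces_mono => k ka [a [va v'a]].
by exists (fun_interp (s := target k) a); split; apply: val_app_symbol.
Qed.

Lemma app_symbol_named f (c : tuples element (fun_dom f)) :
  exists d : element (fun_cod f), names d (app_symbol (fun s i => name (c s i))).
Proof.
by apply/names_of/same_app_symbol => s i; apply: names_refl (nameP _).
Qed.

Definition term_model : structure L := {|
  carrier := element;
  fun_interp := fun f c => projT1 (cid (app_symbol_named c));
  rel_interp := fun R c =>
    G (Fact (fun s i => name (c s i)) (p_atom (a_rel (fun s i => t_var i)))) |}.

Fixpoint symbol_of_term y (v : tuples symbol y) s (t : term y s) : symbol s :=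
  match t with
  | t_var _ i => v _ i
  | t_app f ts => app_symbol (fun s i => symbol_of_term v (ts s i))
  end.

Lemma val_symbol_of_term k y (v : tuples symbol y) (a : tuples (target k) y) s
    (t : term y s) :
  admissible k -> values v a ->
  val k (symbol_of_term v t) = Some (eval a t).
Proof.
move=> ka va; elim: t => [t i|f ts IH] /=; first exact: va.
by apply: val_app_symbol => // t i; apply: IH.
Qed.

Lemma names_eval y (c : tuples element y) (v : tuples symbol y) s
    (t : term y s) :
  names_tuple c v ->
  names (@eval L term_model _ c _ t) (symbol_of_term v t).
Proof.
move=> cv; elim: t => [t i|f ts IH] /=; first exact: cv.
case: cid => d /= dP; apply/(names_same _ dP)/same_app_symbol => t i.
exact/(names_same _ (nameP _)).
Qed.

Lemma names_tuple_values y (c : tuples element y) (v : tuples symbol y) :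
  names_tuple c v ->
  forces (fun k => exists a : tuples (target k) y, values v a).
Proof.
move=> cv; have := same_tuple (fun s i => names_refl (cv s i)).
by apply: forces_mono => k _ [a []]; exists a.
Qed.

Lemma values_inj k y (v : tuples symbol y) (a b : tuples (target k) y) :
  values v a -> values v b -> a = b.
Proof.
by move=> va vb; apply: tuples_eq => s i; have := va s i; rewrite vb => -[].
Qed.

Lemma sat_atomic_term_model y (alpha : atomic y) (c : tuples element y)
    (v : tuples symbol y) :
  names_tuple c v ->
  @sat_atomic L term_model _ alpha c <-> G (Fact v (p_atom alpha)).
Proof.
move=> cv; have vdef := names_tuple_values cv; case: alpha => [||s t u|R ts] /=.
- split=> // _; apply/forcesP; apply: forces_mono vdef => k _ [a va].
  by exists a.
- by split=> // /forcesP/forces_consistent[k _ [a []]].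
- have ct := names_eval t cv; have cu := names_eval u cv.
  have -> : (@eval L term_model _ c _ t = @eval L term_model _ c _ u) <->
      same (symbol_of_term v t) (symbol_of_term v u).
    rewrite -(names_same _ ct); split=> [->//|ctu].
    exact: names_inj ctu cu.
  rewrite -forcesP /same; split.
    move=> h; apply: forces_mono (forces_and vdef h) => k ka [[a va] [m []]].
    rewrite !(val_symbol_of_term _ ka va) => -[tm] [um].
    by exists a; split=> //=; rewrite tm um.
  apply: forces_mono => k ka [a [va /= tu]].
  by exists (eval a t); rewrite !(val_symbol_of_term _ ka va) /= tu.
- have cts s i : same (name (@eval L term_model _ c _ (ts s i)))
      (symbol_of_term v (ts s i)).
    exact/(names_same _ (nameP _))/names_eval.
  rewrite -!forcesP; split=> h.
    apply: forces_mono (forces_and (forces_and vdef (same_tuple cts)) h) => k ka.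
    move=> [[[a va] [b [nb vb]]] [b' [nb' /=]]].
    have -> : b' = b by exact: values_inj nb' nb.
    move=> Rb; exists a; split=> //=.
    suff <- : b = (fun s i => eval a (ts s i)) by [].
    apply: tuples_eq => s i.
    by have := vb s i; rewrite (val_symbol_of_term _ ka va) => -[].
  apply: forces_mono (forces_and (same_tuple cts) h) => k ka.
  move=> [[b [nb vb]] [a [va /= Ra]]]; exists b; split=> //=.
  suff -> : b = (fun s i => eval a (ts s i)) by [].
  apply: tuples_eq => s i.
  by have := vb s i; rewrite (val_symbol_of_term _ ka va) => -[].
Qed.

Lemma G_witness s y (v : tuples symbol y) (phi : positive_formula (s :: y)) :
  same (witness v phi) (witness v phi) ->
  G (Fact (tcons (M := symbol) (witness v phi) v) phi).
Proof.
move=> ww; apply/forcesP; apply: forces_mono ww => k [_ strict _] [m [wm _]].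
have [a [va am]] := strict _ _ _ _ _ wm.
by exists (tcons m a); split=> //; apply: var_case.
Qed.

Lemma values_tcons k s y w (v : tuples symbol y) (a : tuples (target k) (s :: y)) :
  values (tcons (M := symbol) w v) a ->
  exists m b, [/\ a = tcons m b, val k w = Some m & values v b].
Proof.
move=> va; exists (a _ (var0 s y)), (fun t i => a _ (varS s i)); split.
- by apply: tuples_eq; apply: var_case.
- exact: (va _ (var0 s y)).
- by move=> t i; apply: (va _ (varS s i)).
Qed.

(** Truth in the term model is membership in [G].  Disjunctions use that a
    maximal set is prime, existential quantifiers that it contains its
    witnesses. *)
Lemma sat_term_model y (phi : positive_formula y) (c : tuples element y)
    (v : tuples symbol y) :
  names_tuple c v ->
  @sat_positive L term_model _ phi c <-> G (Fact v phi).
Proof.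
elim: phi c v => {y} [y alpha|y phi IHphi psi IHpsi|y phi IHphi psi IHpsi|y s phi IH] c v cv /=.
- exact: sat_atomic_term_model.
- rewrite (IHphi _ _ cv) (IHpsi _ _ cv) -!forcesP; split=> [[h1 h2]|h].
    apply: forces_mono (forces_and h1 h2) => k _ [[a [va ?]] [b [vb ?]]].
    by exists a; split=> //; split=> //; rewrite (values_inj va vb).
  by split; apply: forces_mono h => k _ [a [va []]]; exists a.
- rewrite (IHphi _ _ cv) (IHpsi _ _ cv); split.
    by rewrite -!forcesP => -[]; apply: forces_mono => k _ [a [va ?]];
       exists a; split=> //; [left|right].
  move=> /forcesP h; apply: forces_or; apply: forces_mono h.
  by move=> k _ [a [va [?|?]]]; [left|right]; exists a.
- have cons (m : element s) w : names m w ->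
      names_tuple (tcons (M := element) m c) (tcons (M := symbol) w v).
    by move=> mw; apply: var_case.
  split=> [[m /(IH _ _ (cons _ _ (nameP m)))]|].
    rewrite -!forcesP; apply: forces_mono => k _ [a [/values_tcons]].
    by move=> [m' [b [-> _ vb]]] sb; exists b; split=> //; exists m'.
  move=> /forcesP h; set w := witness v phi.
  have ww : same w w.
    by apply/sameE; apply: forces_mono h => k [_ _]; apply.
  have [m mw] := names_of ww.
  by exists m; apply/(IH _ _ (cons _ _ mw))/G_witness.
Qed.

(** Every admissible valuation takes its values in a model of [T], so [G] is
    closed under the implications in [T]. *)
Lemma model_term_model : model T term_model.
Proof.
move=> theta Ttheta.
have {Ttheta} : forall M, model T M -> sat_h_inductive M theta.
  by move=> M; apply.
elim: theta => [//|c theta IH] h /=; split; last first.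
  by apply: IH => M /h[].
move=> a.
have cv : names_tuple a (fun s i => name (a s i)) by move=> s i; apply: nameP.
rewrite !(sat_term_model _ cv) -!forcesP; apply: forces_mono.
move=> k [/h[kc _] _ _] [b [vb sb]].
by exists b; split=> //; apply: kc.
Qed.

Lemma G_named F : G F -> exists c, names_tuple c (fact_args F).
Proof.
move=> /forcesP GF.
have vdef s i : same (fact_args F s i) (fact_args F s i).
  by apply/sameE; apply: forces_mono GF => k _ [a [va _]]; exists (a s i).
exists (fun s i => projT1 (cid (names_of (vdef s i)))) => s i.
by case: cid.
Qed.

(** The valuation in [N] induced by a map [g] from the term model. *)
Definition image_val N (g : forall s, element s -> N s) s (w : symbol s) :
    option (N s) :=
  if pselect (exists c : element s, names c w) is left ex
  then Some (g s (projT1 (cid ex))) else None.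

Lemma image_valE N (g : forall s, element s -> N s) s (w : symbol s) c :
  names c w -> image_val g w = Some (g s c).
Proof.
rewrite /image_val => cw; case: pselect => [ex|[]]; last by exists c.
by case: cid => c' /= c'w; rewrite (names_inj c'w cw).
Qed.

Lemma image_val_inv N (g : forall s, element s -> N s) s (w : symbol s) m :
  image_val g w = Some m -> exists2 c, names c w & m = g s c.
Proof.
by rewrite /image_val; case: pselect => // ex [<-]; case: cid => c /=; exists c.
Qed.

Lemma G_holds N (g : forall s, element s -> N s)
    (e : forall s, symbol s -> option (N s)) F :
  @homomorphism L term_model N g ->
  (forall s w m, image_val g w = Some m -> e s w = Some m) ->
  G F -> holds (Valuation e) F.
Proof.
move=> hg ge; case: F => y v phi GF; have [c cv] := G_named GF.
exists (tmap g c); split; first by move=> s i; apply/ge/image_valE.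
by apply: sat_positive_hom hg _; apply/(sat_term_model _ cv).
Qed.

(** A homomorphism to a model [N] of [T] induces a partial valuation in [N],
    which extends to an admissible one satisfying [G].  If [phi] holds in [N] of
    the image of [a], this valuation shows that [phi], said of the names of
    [a], is consistent with [G]; by maximality it belongs to [G]. *)
Lemma positive_term_model : positive_model T term_model.
Proof.
split; first exact: model_term_model.
move=> N g TN hg; split=> // y phi a sa.
have [|e [ea ge]] := @admissible_extension N (image_val g) TN.
  move=> s y' v psi m /image_val_inv[c cw ->].
  have Gw := G_witness (names_refl cw).
  have [b bP] := G_named Gw.
  have vb t i := image_valE g (bP _ (varS s i) : names _ (v t i)).
  have /= wb := names_inj cw (bP _ (var0 s y')).
  exists (tmap g (fun t i => b _ (varS s i))); split=> //.
  rewrite wb -tmap_tcons; apply: sat_positive_hom hg _.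
  suff -> : tcons (b _ (var0 s y')) (fun t i => b _ (varS s i)) = b.
    exact/(sat_term_model _ bP).
  by apply: tuples_eq; apply: var_case.
have cv : names_tuple a (fun s i => name (a s i)) by move=> s i; apply: nameP.
apply/(sat_term_model _ cv); apply: Gmax => l lG.
exists (Valuation e); split=> // F /lG[->|]; last exact: (G_holds hg ge).
by exists (tmap g a); split=> // s i; apply/ge/image_valE.
Qed.

End TermModel.

(** Compactness and the existence of positive models at the same time: the
    hypothesis only concerns finite subsets of [G0]. *)
Theorem realisation_in_positive_model (G0 : set fact) :
  consistent_facts G0 ->
  exists (N : structure L) (d : forall s, symbol s -> option (N s)),
    positive_model T N /\ forall F, G0 F -> holds (Valuation d) F.
Proof.
move=> /maximal_consistent_extension[G [G0G Gc Gmax]].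
exists (term_model G), (@image_val G (term_model G) (fun s => id)).
split; first exact: positive_term_model Gc Gmax.
move=> F /G0G; exact: (@G_holds G Gc Gmax (term_model G) (fun s => id)).
Qed.

End Henkin.

(** * Extending a tuple to a positive model *)

(** The parameters are the variables [x] themselves, and the facts to realise
    are the positive type of [a], which is satisfied in [M]. *)
Lemma tp_positive_in_positive_model (L : language) (T : theory L)
    (x : seq (sorts L)) (M : structure L) (a : tuples M x) :
  model T M ->
  exists (N : structure L) (b : tuples N x),
    positive_model T N /\ tp_positive a `<=` tp_positive b.
Proof.
move=> TM; pose B := var x.
pose G0 : set (fact B) := [set F | exists2 phi : positive_formula x,
  sat_positive phi a & F = given_fact (B := B) (fun s i => i) phi].
have /realisation_in_positive_model[N [d [Npos dG0]]] : consistent_facts T G0.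
  move=> l lG0.
  have [e [ea eE]] :=
    admissible_of_partial_map (B := B) (fun s i => Some (a s i)) TM.
  exists (Valuation e); split=> // F /lG0[phi sa ->].
  by exists a; split=> // s i; apply: eE.
have /dG0[b [bd _]] : G0 (given_fact (B := B) (fun s i => i) (p_atom a_top)).
  by exists (p_atom a_top).
exists N, b; split=> // phi sa.
have /dG0[b' [b'd /=]] : G0 (given_fact (B := B) (fun s i => i) phi).
  by exists phi.
by rewrite (values_inj b'd bd).
Qed.

(** * Types of tuples in positive models are maximal *)

Section Diagram.
Context (L : language) (N : structure L).
Implicit Types (x y : seq (sorts L)) (M : structure L).

Definition diagram : set (fact N) :=
  [set F | exists y (n : tuples N y) (alpha : atomic y),
     sat_atomic alpha n /\ F = given_fact (B := N) n (p_atom alpha)].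

Definition preserved M (h : forall s, N s -> option (M s)) (F : fact N) :
    Prop :=
  exists y (n : tuples N y) (alpha : atomic y) (c : tuples M y),
    [/\ F = given_fact (B := N) n (p_atom alpha),
        forall s i, h s (n s i) = Some (c s i) & sat_atomic alpha c].

(** An element that occurs several times in [b] is sent to the entry of [c] at
    one chosen position. *)
Definition partial_map x (b : tuples N x) M (c : tuples M x) s (m : N s) :
    option (M s) :=
  if pselect (exists j, b s j = m) is left ex
  then Some (c s (projT1 (cid ex))) else None.

Lemma partial_mapE x (b : tuples N x) y (n : tuples N y) :
  (forall s i, exists j, b s j = n s i) ->
  exists r : tuples (var x) y, tmap b r = n /\
    forall M (c : tuples M x) s i,
      partial_map b c (n s i) = Some (c s (r s i)).
Proof.
move=> bn; exists (fun s i => projT1 (cid (bn s i))); split.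
  by apply: tuples_eq => s i; rewrite /tmap; case: cid.
move=> M c s i; rewrite /partial_map; case: pselect => [ex|[]] //.
by rewrite (Prop_irrelevance ex (bn s i)).
Qed.

(** The formula [chi] is the conjunction of the given facts, every element
    being replaced by the variable at its chosen position in [b]. *)
Lemma local_type_range (l : seq (fact N)) x (b : tuples N x) :
  (forall F, List.In F l -> exists y (n : tuples N y) (alpha : atomic y),
     [/\ sat_atomic alpha n, F = given_fact (B := N) n (p_atom alpha) &
         forall s i, exists j, b s j = n s i]) ->
  exists chi : positive_formula x, sat_positive chi b /\
    forall M (c : tuples M x), sat_positive chi c ->
    forall F, List.In F l -> preserved (partial_map b c) F.
Proof.
elim: l => [|F l IH] lb; first by exists (p_atom a_top).
have [chi [bchi chiP]] := IH (fun F' h => lb F' (or_intror h)).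
have [y [n [alpha [nalpha FE bn]]]] := lb F (or_introl erefl).
have [r [rn rP]] := partial_mapE bn.
exists (p_and (p_atom (rename_atomic r alpha)) chi); split=> /=.
  by split=> //; apply/sat_rename_atomic; rewrite rn.
move=> M c [/sat_rename_atomic calpha /chiP cl] F' [<-|/cl //].
by exists y, n, alpha, (tmap c r).
Qed.

(** The elements that occur in the facts of [l] are adjoined to [b] one at a
    time, each adding an existential quantifier to [chi].  The map [h] sends an
    entry of [b] to an entry of [c] at a possibly different position [j]: the
    equalities between entries of [b] are not part of [chi]. *)
Lemma local_type (l : seq (fact N)) x (b : tuples N x) :
  (forall F, List.In F l -> diagram F) ->
  exists chi : positive_formula x, sat_positive chi b /\
    forall M (c : tuples M x), sat_positive chi c ->
    exists h : forall s, N s -> option (M s),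
      (forall s i, exists2 j, b s j = b s i & h s (b s i) = Some (c s j)) /\
      forall F, List.In F l -> preserved h F.
Proof.
move=> lD.
have [u uP] : exists u : seq {s & N s}, forall F, List.In F l ->
    exists y (n : tuples N y) (alpha : atomic y),
    [/\ sat_atomic alpha n, F = given_fact (B := N) n (p_atom alpha) &
        forall s i, List.In (existT N s (n s i)) u].
  elim: l lD => [|F l IH] lD; first by exists [::].
  have [u uP] := IH (fun F' h => lD F' (or_intror h)).
  have [y [n [alpha [nalpha FE]]]] := lD F (or_introl erefl).
  have [w wP] : exists w : seq {s & N s},
      forall s i, List.In (existT N s (n s i)) w.
    elim: y n {alpha nalpha FE} => [|t y IHy] n.
      by exists [::] => s i; case: (var_nil i).
    have [w wP] := IHy (fun s i => n s (varS t i)).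
    exists (existT N t (n t (var0 t y)) :: w).
    by apply: var_case => [|s i]; [left|right].
  exists (w ++ u) => F' [<-|/uP[y' [n' [alpha' [? ? n'u]]]]].
    by exists y, n, alpha; split=> // s i; apply/List.in_app_iff; left.
  by exists y', n', alpha'; split=> // s i; apply/List.in_app_iff; right.
have {lD}uP : forall F, List.In F l ->
    exists y (n : tuples N y) (alpha : atomic y),
    [/\ sat_atomic alpha n, F = given_fact (B := N) n (p_atom alpha) &
        forall s i, (exists j, b s j = n s i) \/
                    List.In (existT N s (n s i)) u].
  move=> F /uP[y [n [alpha [? ? nu]]]]; exists y, n, alpha.
  by split=> // s i; right.
(* An element already in [b] is not adjoined again, so that the positions
   chosen for the entries of [b] lie in [x]. *)
elim: u x b uP => [|[t m] u IH] x b uP.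
  have [|chi [bchi chiP]] := @local_type_range l x b.
    move=> F /uP[y [n [alpha [? ? nb]]]]; exists y, n, alpha.
    by split=> // s i; have [] := nb s i.
  exists chi; split=> // M c cchi; exists (partial_map b c).
  split; last exact: chiP.
  have [|r [rb rP]] := @partial_mapE x b x b; first by move=> s i; exists i.
  by move=> s i; exists (r s i); [rewrite -[in RHS]rb | apply: rP].
have [bm|nbm] := pselect (exists j, b t j = m).
  apply: IH => F /uP[y [n [alpha [? ? nb]]]]; exists y, n, alpha.
  split=> // s i; have [|[E|]] := nb s i; [by left| |by right].
  left.
  (* Stated through the projections, the claim can be transported along [E]
     without inverting an equality of dependent pairs. *)
  by have : exists j, b (projT1 (existT N s (n s i))) j =
                      projT2 (existT N s (n s i)) by rewrite -E.
have [|chi [bchi chiP]] := IH (t :: x) (tcons m b).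
  move=> F /uP[y [n [alpha [? ? nb]]]]; exists y, n, alpha.
  split=> // s i; have [[j <-]|[E|]] := nb s i; last by right.
    by left; exists (varS t j).
  left.
  have : exists j : var (t :: x) (projT1 (existT N s (n s i))),
      tcons m b j = projT2 (existT N s (n s i)).
    by rewrite -E; exists (var0 t x).
  by [].
exists (p_ex chi); split; first by exists m.
move=> M c [m' /chiP[h [hb hl]]]; exists h; split=> // s i.
have [j] := hb s (varS t i).
move: s j i; apply: var_case => [i /= E|s j i /= E] hE.
  by case: nbm; exists i.
by exists j.
Qed.

End Diagram.

Arguments diagram {L} N.

(** The diagram of [N] and the formulas of [q] at [b] are realised together in a
    model [N'] of [T], which gives a homomorphism from [N] to [N'].  It is an
    immersion, so [b] satisfies [q] in [N]. *)
Lemma tp_positive_maximal (L : language) (T : theory L) (x : seq (sorts L))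
    (N : structure L) (b : tuples N x) :
  positive_model T N -> positive_types T x (tp_positive b).
Proof.
move=> [TN Npos]; split; first by exists N, b.
move=> q [M [c [TM cq]]] bq; apply/seteqP; split=> // phi qphi.
pose G0 : set (fact N) := diagram N `|`
  [set F | exists2 psi, q psi & F = given_fact (B := N) b psi].
have /realisation_in_positive_model[N' [d [[TN' _] dG0]]] :
    consistent_facts T G0.
  move=> l lG0.
  have [|chi [bchi chiP]] :=
      @local_type L N (List.filter (fun F => `[< diagram N F >]) l) x b.
    by move=> F /List.filter_In[_ /asboolP].
  have [h [hb hl]] := chiP M c (cq _ (bq _ bchi)).
  have [e [ea eh]] := admissible_of_partial_map h TM.
  exists (Valuation e); split=> // F Fl; have [DF|[psi qpsi ->]] := lG0 F Fl.
    have [|y [n [alpha [a [-> na aalpha]]]]] := hl F.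
      by apply/List.filter_In; split=> //; apply/asboolP.
    by exists a; split=> // s i; apply/eh/na.
  exists c; split; last exact: cq.
  (* Equalities between entries of [b] are in its type, hence in [q]. *)
  move=> s i; apply: eh; have [j bji ->] := hb s i; congr Some.
  exact: (cq _ (bq (p_atom (a_eq (t_var j) (t_var i))) bji)).
have dtotal s (m : N s) : exists m', d s (given m) = Some m'.
  pose n : tuples N [:: s] := tcons m (fun t i => False_rect _ (var_nil i)).
  have /dG0[a [da _]] : G0 (given_fact (B := N) n (p_atom a_top)).
    by left; exists [:: s], n, a_top.
  by exists (a s (var0 s [::])); apply: (da s (var0 s [::])).
pose f s (m : N s) : N' s := projT1 (cid (dtotal s m)).
have fE s (m : N s) : d s (given m) = Some (f s m) by rewrite /f; case: cid.
have holdsE y (n : tuples N y) psi :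
    G0 (given_fact (B := N) n psi) -> sat_positive psi (tmap f n).
  move=> /dG0[a [da sa]]; suff <- : a = tmap f n by [].
  by apply: (values_inj da) => s i; apply: fE.
have [|_ fimm] := Npos N' f TN'.
  move=> y alpha n nalpha; apply: (holdsE y n (p_atom alpha)).
  by left; exists y, n, alpha.
by apply: fimm; apply: holdsE; right; exists phi.
Qed.

(** * The bijection *)

Lemma positive_type_realised (L : language) (T : theory L)
    (x : seq (sorts L)) (p : set (positive_formula x)) :
  positive_types T x p ->
  exists (M : structure L) (a : tuples M x), realisation T p a.
Proof.
move=> [[M [a [TM pa]]] pmax].
have [N [b [Npos ab]]] := tp_positive_in_positive_model a TM.
exists N, b; split=> //; apply/esym/pmax.
  by exists N, b; split=> //; case: Npos.
by move=> phi /pa/ab.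
Qed.

Lemma star_realisation (L : language) (T : theory L) (x : seq (sorts L))
    (p : set (positive_formula x)) (M : structure L) (a : tuples M x) :
  realisation T p a -> star T x p = tp_geometric a.
Proof.
move=> pa; rewrite /star.
have : exists q, [set q | exists (M : structure L) (a : tuples M x),
    realisation T p a /\ q = tp_geometric a] q by exists (tp_geometric a), M, a.
move=> /getPex[N [b [[_ pb] ->]]]; case: pa => _ pa.
by apply/seteqP; split; apply: tp_geometric_mono; rewrite -pa -pb.
Qed.

Theorem proposition2p4 (L : language) (T : theory L) (x : seq (sorts L)) :
  (forall p : set (positive_formula x), positive_types T x p ->
     forall (M : structure L) (a : tuples M x),
       realisation T p a -> star T x p = tp_geometric a) /\
  set_bij (positive_types T x) (maximal_normal_types T x) (star T x).
Proof.
split; first by move=> p _ M a; apply: star_realisation.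
split.
- move=> p pT; have [N [b [Npos pb]]] := positive_type_realised pT.
  rewrite /= (star_realisation (conj Npos pb)); split.
    split; first by move=> phi [].
    by exists N, b; case: Npos => TN _; split=> // phi [].
  move=> q [qn [M [c [TM cq]]]] bq.
  have bc := tp_positive_of_geometric bq cq.
  have cb : tp_positive c = tp_positive b.
    rewrite -pb; apply: (proj2 pT); last by rewrite pb.
    by exists M, c.
  apply/seteqP; split=> // phi qphi.
  apply: (@tp_geometric_mono _ _ _ _ c b); first by rewrite cb.
  by split; [apply: qn | apply: cq].
- move=> p p' /set_mem/positive_type_realised[M [a [Mpos pa]]].
  move=> /set_mem/positive_type_realised[N [b [Npos pb]]].
  rewrite (star_realisation (conj Mpos pa)) (star_realisation (conj Npos pb)).
  rewrite pa pb => ab.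
  apply/seteqP; split.
    by apply: (@tp_positive_of_geometric _ _ _ _ _ _ (tp_geometric b));
       [rewrite ab | move=> phi []].
  by apply: (@tp_positive_of_geometric _ _ _ _ _ _ (tp_geometric a));
     [rewrite ab | move=> phi []].
- move=> q [[qn [M [a [TM aq]]]] qmax].
  have [N [b [Npos ab]]] := tp_positive_in_positive_model a TM.
  exists (tp_positive b); first exact: tp_positive_maximal.
  rewrite (star_realisation (conj Npos erefl)); apply: qmax.
    split; first by move=> phi [].
    by exists N, b; case: Npos => TN _; split=> // phi [].
  move=> phi qphi; apply: (tp_geometric_mono ab).
  by split; [apply: qn | apply: aq].
Qed.
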